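(* Let $q$ be a prime power, $m,s$ positive integers, and $\mathcal{R}_{q,s}=\mathbb{F}_q[x]/\langle x^s-1\rangle$. Let $x^s-1=\prod_{j=1}^t f_j^{s_j}$ be the decomposition of $x^s-1$ in $\mathbb{F}_q[x]$ into powers of distinct irreducible factors, and $d_j=\deg(f_j)$ for $j=1,\dots,t$. Then: 1. $\displaystyle |U(\mathcal{R}_{q,s})|=\prod_{j=1}^t\left(q^{d_j}-1\right)q^{d_j(s_j-1)}$. 2. $\displaystyle |SL_m(\mathcal{R}_{q,s})|=\frac{q^{m^2 s}\prod_{j=1}^t\prod_{i=1}^m\left(1-q^{-i d_j}\right)}{\prod_{j=1}^t\left(q^{d_j}-1\right)q^{d_j(s_j-1)}}$. 3. $\displaystyle |B_m(\mathcal{R}_{q,s})|=q^{s\frac{m(m-1)}{2}}\left(\prod_{j=1}^t\left(q^{d_j}-1\right)q^{d_j(s_j-1)}\right)^m$. 4. $\displaystyle |D_m(\mathcal{R}_{q,s})|=\left(\prod_{j=1}^t\left(q^{d_j}-1\right)q^{d_j(s_j-1)}\right)^m$.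
   Context: $U(\mathcal{R}_{q,s})$ is the group of units of $\mathcal{R}_{q,s}$. $GL_m(\mathcal{R}_{q,s})$ is the group of invertible $m\times m$ matrices over $\mathcal{R}_{q,s}$, $SL_m(\mathcal{R}_{q,s})$ its subgroup of matrices of determinant $1$, $B_m(\mathcal{R}_{q,s})$ its subgroup of invertible upper triangular matrices, and $D_m(\mathcal{R}_{q,s})$ its subgroup of invertible diagonal matrices. *)

(* Defs.v *)
From HB Require Import structures.
From mathcomp Require Import all_boot all_order all_algebra all_fingroup.

Set Implicit Arguments.
Unset Strict Implicit.
Unset Printing Implicit Defensive.
Set Warnings "-redundant-canonical-projection".

Import GRing.Theory.
Local Open Scope ring_scope.

Definition cyclic_ring (F : finFieldType) (s : nat) :=
  {poly %/ ('X^s - 1 : {poly F})}.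

HB.instance Definition _ (F : finFieldType) (s : nat) :=
  GRing.ComUnitRing.on (cyclic_ring F s).
HB.instance Definition _ (F : finFieldType) (s : nat) :=
  Finite.on (cyclic_ring F s).

(* [{poly %/ h}] is the quotient by ['X] unless [h] is monic of positive
   degree; the next lemma excludes this degenerate case. *)
Lemma cyclic_ring_modulus (F : finFieldType) (s : nat) :
  (0 < s)%N -> mk_monic ('X^s - 1 : {poly F}) = 'X^s - 1.
Proof.
move=> s_gt0; rewrite /mk_monic size_XnsubC // ltnS s_gt0 /=.
by rewrite monicXnsubC.
Qed.

(* The elements of [{'GL_m[R]}] are the invertible matrices of size [m.-1.+1],
   so the groups below are the intended ones for [0 < m] only. *)
Section MatrixGroups.

Variables (m : nat) (R : finComUnitRingType).
Implicit Types A : {'GL_m[R]}.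

Definition SLset := [set A : {'GL_m[R]} | \det (GLval A) == 1].

(* [is_trig_mx] means lower triangular, hence the transpose. *)
Definition Bset := [set A : {'GL_m[R]} | is_trig_mx (GLval A)^T].

Definition Dset := [set A : {'GL_m[R]} | is_diag_mx (GLval A)].

Fact SL_group_set : group_set SLset.
Proof.
apply/group_setP; split=> [|A B]; first by rewrite inE det1.
by rewrite !inE => /eqP dA /eqP dB; rewrite /= det_mulmx dA dB mulr1.
Qed.
Canonical SLgroup : {group {'GL_m[R]}} := Group SL_group_set.

Fact B_group_set : group_set Bset.
Proof.
apply/group_setP; split=> [|A B]; first by rewrite inE trmx1 scalar_mx_is_trig.
rewrite !inE => /is_trig_mxP tA /is_trig_mxP tB; apply/is_trig_mxP => i j lt_ij.
rewrite !mxE big1 // => k _; have [lt_ik | le_ki] := ltnP i k.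
  by have := tB _ _ lt_ik; rewrite mxE => ->; rewrite mulr0.
by have := tA _ _ (leq_ltn_trans le_ki lt_ij); rewrite mxE => ->; rewrite mul0r.
Qed.
Canonical Bgroup : {group {'GL_m[R]}} := Group B_group_set.

Fact D_group_set : group_set Dset.
Proof.
apply/group_setP; split=> [|A B]; first by rewrite inE scalar_mx_is_diag.
rewrite !inE => /is_diag_mxP dA /is_diag_mxP dB; apply/is_diag_mxP => i j neq_ij.
rewrite mxE big1 // => k _; have [eq_ik | neq_ik] := eqVneq (i : nat) k.
  by rewrite dB ?mulr0 // -eq_ik.
by rewrite dA ?mul0r.
Qed.
Canonical Dgroup : {group {'GL_m[R]}} := Group D_group_set.

End MatrixGroups.

(* Main.v *)
Require Import Defs.
From HB Require Import structures.
From mathcomp Require Import all_boot all_order all_algebra all_fingroup all_field zify ring.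

Set Implicit Arguments.
Unset Strict Implicit.
Unset Printing Implicit Defensive.

Import Order.TTheory GRing.Theory Num.Theory.
Local Open Scope ring_scope.

(** Let R = F[x]/(h) with h = x^s - 1, let g_j be the monic associate of f_j
    and K_j = F[x]/(g_j), a field with Q_j = q^(d_j) elements.  A class is a
    unit of R exactly when its representative is prime to h, that is, when none
    of its residues in the K_j vanishes.  Hence a square matrix over R is
    invertible if and only if all its residue matrices over the K_j are
    ([unitmx_residues]).  By the Chinese remainder theorem ([poly_chinese]) the
    residue map from M_m(R) to the product of the M_m(K_j) is onto; it is
    additive, so all its fibres have the same size ([card_preim_translation]).
    The density of GL_m(R) in M_m(R) is therefore the product of the densities
    of GL_m(K_j) in M_m(K_j) ([card_GL_residues]), and the order of GL_m over a
    finite field gives |GL_m(R)|.  The structure of the local factors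
    F[x]/(f_j^(e_j)) never intervenes: the exponents e_j enter only through
    |R| = q^s and s = sum_j d_j e_j.

    The case m = 1 is the number of units.  A triangular or diagonal matrix is
    invertible if and only if its diagonal entries are units, so B_m and D_m are
    counted entry by entry; and the determinant maps GL_m(R) onto the units with
    fibres of size |SL_m(R)|, which gives SL_m as a quotient. *)

(** * Fibres of equal size *)

Lemma card_preim_uniform (T U : finType) (h : T -> U) (k : nat) :
    (forall u, #|[set x | h x == u]| = k) ->
  forall A : {set U}, #|h @^-1: A| = (#|A| * k)%N.
Proof.
move=> hk A; rewrite -sum1_card (partition_big h (mem A)) /=; last first.
  by move=> x; rewrite inE.
rewrite -sum_nat_const; apply: eq_bigr => u Au.
rewrite -(hk u) sum1dep_card; apply: eq_card => x; rewrite !inE.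
by case: eqP => [->|]; rewrite ?Au ?andbF.
Qed.

(** The second hypothesis says that h factors as an additive map followed by a
    bijection; stating it this way avoids giving U a group structure, which
    matters when U is a dependent product.  Every fibre is a translate of the
    fibre of h 0. *)
Lemma card_preim_translation (V : finZmodType) (U : finType) (h : V -> U) :
    (forall u, exists x, h x = u) ->
    (forall x y z, h x = h y -> h (x + z) = h (y + z)) ->
  forall A : {set U}, (#|h @^-1: A| * #|U| = #|V| * #|A|)%N.
Proof.
move=> h_onto h_add A; have h_fib u : #|[set x | h x == u]| = #|[set x | h x == h 0]|.
  have [v <-] := h_onto u; rewrite -[RHS](card_imset _ (addIr v)).
  apply: eq_card => x; apply/idP/imsetP => [|[y]]; rewrite !inE.
    move=> /eqP hx; exists (x - v); last by rewrite subrK.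
    by rewrite inE -(subrr v) (h_add x v).
  by move=> /eqP hy ->; rewrite (h_add y 0) // add0r.
have hE := card_preim_uniform h_fib.
have: #|V| = (#|U| * #|[set x | h x == h 0%R]|)%N.
  by rewrite -[#|U|]cardsT -hE preimsetT cardsT.
by move=> ->; rewrite hE mulnC -mulnA (mulnC #|A|).
Qed.

(** * Counting matrices over a finite commutative ring *)

Lemma card_GL_unitmx (R : finComUnitRingType) n :
  #|'GL_n.+1[R]%g| = #|[set A : 'M[R]_n.+1 | A \in unitmx]|.
Proof. by rewrite cardsT card_sub cardsE. Qed.

Lemma card_mx_entries (T : finType) m n (S : 'I_m -> 'I_n -> {set T}) :
  #|[set A : 'M[T]_(m, n) | [forall i, forall j, A i j \in S i j]]|
    = (\prod_i \prod_j #|S i j|)%N.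
Proof.
pose S' := fun ij : 'I_m * 'I_n => mem (S ij.1 ij.2).
transitivity #|(family S' : {pred {ffun 'I_m * 'I_n -> T}})|.
  pose mxv (A : 'M[T]_(m, n)) : {ffun 'I_m * 'I_n -> T} := [ffun ij => A ij.1 ij.2].
  have mxv_inj : injective mxv.
    by move=> A B /ffunP AB; apply/matrixP => i j; have := AB (i, j); rewrite !ffunE.
  rewrite -(card_imset _ mxv_inj); apply: eq_card => g.
  apply/imsetP/familyP => [[A] | gS].
    by rewrite inE => /forallP SA -> [i j]; rewrite ffunE; apply: (forallP (SA i)).
  exists (\matrix_(i, j) g (i, j)); last first.
    by apply/ffunP => -[i j]; rewrite ffunE mxE.
  by rewrite inE; apply/forallP => i; apply/forallP => j; rewrite mxE; apply: (gS (i, j)).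
by rewrite card_family /image_mem foldrE big_map big_enum /= pair_bigA.
Qed.

(** * Invertible matrices and residue fields *)

(** The hypotheses say that R modulo its Jacobson radical is the product of the
    fields K i, the maps phi i being the projections. *)
Section Residues.

Variables (R : finComUnitRingType) (I : finType) (K : I -> finFieldType).
Variable phi : forall i, {rmorphism R -> K i}.
Hypothesis phi_onto : forall y : (forall i, K i), exists x, forall i, phi i x = y i.
Hypothesis phi_unit : forall x, (forall i, phi i x != 0) -> x \is a GRing.unit.

(** Invertibility is read on the determinant, which commutes with phi i. *)
Lemma unitmx_residues n (A : 'M[R]_n) :
  (A \in unitmx) = [forall i, map_mx (phi i) A \in unitmx].
Proof.
apply/idP/forallP => [uA i | uA].
  by rewrite unitmxE det_map_mx rmorph_unit // -unitmxE.
rewrite unitmxE; apply: phi_unit => i; rewrite -det_map_mx -unitfE -unitmxE.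
exact: uA.
Qed.

(** GL_n(R) is the preimage of the product of the GL_n(K i) under the residue
    map, whose fibres all have the same size. *)
Lemma card_GL_residues n :
  (#|'GL_n.+1[R]%g| * \prod_i #|K i| ^ (n.+1 * n.+1) =
   #|R| ^ (n.+1 * n.+1) * \prod_i #|'GL_n.+1[K i]%g|)%N.
Proof.
pose P := {dffun forall i, 'M[K i]_n.+1}.
pose h (A : 'M[R]_n.+1) : P := [ffun i => map_mx (phi i) A].
have h_onto u : exists A, h A = u.
  have /fin_all_exists[A hA] (ij : 'I_n.+1 * 'I_n.+1) :
      exists x, forall i, phi i x = u i ij.1 ij.2 by apply: phi_onto.
  (* [phi_onto] is used in each entry separately *)
  exists (\matrix_(i, j) A (i, j)); apply/ffunP => i; rewrite ffunE.
  by apply/matrixP => k l; rewrite !mxE hA.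
have h_add A B C : h A = h B -> h (A + C) = h (B + C).
  move=> /ffunP hAB; apply/ffunP => i; have := hAB i.
  by rewrite !ffunE !map_mxD => ->.
pose G : {set P} := [set u : P | [forall i, (u : P) i \in unitmx]].
have := card_preim_translation h_onto h_add G.
have ->: h @^-1: G = [set A | A \in unitmx].
  apply/setP => A; rewrite !inE unitmx_residues.
  by apply: eq_forallb => i; rewrite ffunE.
have ->: #|P| = (\prod_i #|K i| ^ (n.+1 * n.+1))%N.
  rewrite card_dep_ffun /image_mem foldrE big_map big_enum /=.
  by apply: eq_bigr => i _; rewrite card_mx.
have ->: #|G| = (\prod_i #|'GL_n.+1[K i]%g|)%N.
  transitivity #|(family (fun i => [pred B : 'M[K i]_n.+1 | B \in unitmx]) : {pred P})|.
    by apply: eq_card => u; rewrite !inE; apply: eq_forallb.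
  rewrite card_family /image_mem foldrE big_map big_enum /=.
  by apply: eq_bigr => i _; rewrite card_GL_unitmx cardsE.
by rewrite card_mx -card_GL_unitmx.
Qed.

End Residues.

(** * Special linear, diagonal and triangular matrices *)

Lemma card_GL_subset (R : finComUnitRingType) n (P : pred 'M[R]_n.+1) :
  #|[set A : {'GL_n.+1[R]} | P (GLval A)]|
    = #|[set A : 'M[R]_n.+1 | (A \in unitmx) && P A]|.
Proof.
rewrite -(card_imset _ (val_inj : injective (@GLval n.+1 R))).
apply: eq_card => A; rewrite inE.
apply/imsetP/andP => [[B PB ->] | [uA PA]].
  by split; [exact: (GL_unitmx B) | rewrite inE in PB].
by exists (Sub A uA : {'GL_n.+1[R]}); rewrite ?inE SubK.
Qed.

Lemma card_unit_set (R : finComUnitRingType) :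
  #|[set x : R | x \is a GRing.unit]| = #|[set: {unit R}]|.
Proof. by rewrite cardsT card_sub cardsE. Qed.

(** The determinant is onto the units, as diag(u, 1, ..., 1) shows; right
    translation by such a matrix carries SL_n onto the fibre above u. *)
Lemma card_SL_units (R : finComUnitRingType) n :
  #|'GL_n.+1[R]%g| = (#|[set: {unit R}]| * #|SLgroup n.+1 R|)%N.
Proof.
have det_unit (A : {'GL_n.+1[R]}) : \det (GLval A) \is a GRing.unit.
  by rewrite -unitmxE GL_unitmx.
pose h A : {unit R} := FinRing.unit R (det_unit A).
rewrite /GLgroup -(preimsetT h); apply: card_preim_uniform => u.
pose D : 'M[R]_n.+1 := diag_mx (\row_j if j == ord0 then val u else 1).
have detD : \det D = val u.
  rewrite det_diag (bigD1 ord0) //= mxE eqxx big1 ?mulr1 // => j j0.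
  by rewrite mxE (negPf j0).
have uD : D \in unitmx by rewrite unitmxE detD (valP u).
pose g : {'GL_n.+1[R]} := Sub D uD.
rewrite -[RHS](card_imset _ (mulIg g)); apply: eq_card => A.
have detg : \det (GLval g) = val u by rewrite /g SubK.
apply/idP/imsetP => [|[B]]; rewrite inE; last first.
  rewrite inE => /eqP SB ->; rewrite -val_eqE /=.
  by rewrite -[X in \det X]/(GLval B *m GLval g) det_mulmx SB mul1r detg.
move=> /eqP/(congr1 val) /= hA; exists (A * g^-1)%g; last by rewrite mulgKV.
rewrite inE; apply/eqP; apply: (mulIr (valP u)).
by rewrite -{1}detg -det_mulmx mul1r -[_ *m _]/(GLval (A * g^-1 * g)%g) mulgKV.
Qed.

Lemma card_diag_units (R : finComUnitRingType) n :
  #|Dgroup n.+1 R| = (#|[set: {unit R}]| ^ n.+1)%N.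
Proof.
pose S (i j : 'I_n.+1) : {set R} :=
  if i == j then [set x : R | x \is a GRing.unit] else [set 0 : R].
transitivity (\prod_(i < n.+1) \prod_(j < n.+1) #|S i j|)%N.
  rewrite -card_mx_entries card_GL_subset; apply: eq_card => A; rewrite !inE.
  have detA : is_diag_mx A -> \det A = \prod_i A i i.
    by move=> dA; rewrite det_trig // is_diag_mx_is_trig.
  apply/andP/forallP => [[uA dA] i | SA].
    apply/forallP => j; rewrite /S; case: eqVneq => [<-|ij].
      move: uA; rewrite unitmxE detA // inE => /unitr_prodP; apply=> //.
    by rewrite in_set1 (is_diag_mxP dA).
  have dA : is_diag_mx A.
    apply/is_diag_mxP => i j ij; have := forallP (SA i) j.
    by rewrite /S -val_eqE (negPf ij) inE => /eqP.
  split=> //; rewrite unitmxE detA // unitr_prod // => i _.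
  by have := forallP (SA i) i; rewrite /S eqxx inE.
rewrite -[in RHS](card_ord n.+1) -prod_nat_const; apply: eq_bigr => i _.
rewrite (bigD1 i) //= big1 /S ?eqxx ?card_unit_set ?muln1 // => j ji.
by rewrite eq_sym (negPf ji) cards1.
Qed.

Lemma card_triangular_units (R : finComUnitRingType) n :
  #|Bgroup n.+1 R| = (#|R| ^ 'C(n.+1, 2) * #|[set: {unit R}]| ^ n.+1)%N.
Proof.
pose S (i j : 'I_n.+1) : {set R} :=
  if i == j then [set x : R | x \is a GRing.unit]
  else if (i < j)%N then [set: R] else [set 0 : R].
transitivity (\prod_(i < n.+1) \prod_(j < n.+1) #|S i j|)%N.
  rewrite -card_mx_entries (card_GL_subset (fun A => is_trig_mx A^T)).
  apply: eq_card => A; rewrite !inE.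
  have detA : is_trig_mx A^T -> \det A = \prod_i A i i.
    by move=> tA; rewrite -det_tr det_trig //; apply: eq_bigr => i _; rewrite mxE.
  apply/andP/forallP => [[uA tA] i | SA].
    apply/forallP => j; rewrite /S; case: eqVneq => [<-|ij].
      move: uA; rewrite unitmxE detA // inE => /unitr_prodP; apply=> //.
    case: ltnP => [|le_ji]; rewrite ?in_set1 ?in_setT //.
    have lt_ji : (j < i)%N by rewrite ltn_neqAle eq_sym val_eqE ij.
    by have := is_trig_mxP tA _ _ lt_ji; rewrite mxE => ->.
  have tA : is_trig_mx A^T.
    apply/is_trig_mxP => i j ij; have := forallP (SA j) i.
    by rewrite mxE /S -val_eqE gtn_eqF // ltnNge ltnW // inE => /eqP.
  split=> //; rewrite unitmxE detA // unitr_prod // => i _.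
  by have := forallP (SA i) i; rewrite /S eqxx inE.
(* By columns: the entries strictly above the diagonal in column j number j. *)
rewrite exchange_big mulnC -[in X in (_ ^ X * _)%N](card_ord n.+1) -prod_nat_const.
rewrite -bin2_sum expn_sum big_mkord -big_split; apply: eq_bigr => j _ /=.
rewrite (bigD1 j) //= {1}/S eqxx card_unit_set; congr muln.
rewrite (eq_bigr (fun i : 'I_n.+1 => if (i < j)%N then #|R| else 1%N)) => [|i ij].
  rewrite -big_mkcondr (eq_bigl (fun i : 'I_n.+1 => (i < j)%N)) => [|i] /=.
    by rewrite (big_ord_narrow (ltnW (ltn_ord j))) prod_nat_const card_ord.
  by rewrite andbC; case: ltnP => //= lt_ij; rewrite -val_eqE ltn_eqF.
by rewrite /S (negPf ij); case: ifP => _; rewrite ?cardsT ?cards1.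
Qed.

(** * Residues of F[x]/(h) modulo an irreducible factor of h *)

(** The Bezout relation between g i and the product of the other g k yields
    c i, congruent to 1 modulo g i and to 0 modulo every other g k; then
    sum_i (y i) (c i) is a solution. *)
Lemma poly_chinese (F : fieldType) (I : finType) (g : I -> {poly F}) :
    (forall i j, i != j -> coprimep (g i) (g j)) ->
  forall y : I -> {poly F}, exists p, forall i, g i %| p - y i.
Proof.
move=> co_g y.
have /fin_all_exists[c cP] (i : I) :
    exists c, g i %| c - 1 /\ forall k, k != i -> g k %| c.
  have: coprimep (g i) (\prod_(k | k != i) g k).
    elim/big_rec: _ => [|k p ki IHp]; first exact: coprimep1.
    by rewrite coprimepMr IHp co_g // eq_sym.
  case/Bezout_eq1_coprimepP=> -[u v] /= uv1; exists (v * \prod_(k | k != i) g k).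
  split=> [|k ki]; first 
    by rewrite -[X in _ - X]uv1 opprD addrCA subrr addr0 dvdpNr dvdp_mull.
  by rewrite (bigD1 k) //= mulrCA dvdp_mulr.
exists (\sum_i y i * c i) => i; have [ci1 _] := cP i.
rewrite (bigD1 i) //= addrAC -{2}[y i]mulr1 -mulrBr dvdp_add ?dvdp_mull //.
apply: (big_ind (fun p => g i %| p)) => [|p r gp gr|k ki]; first exact: dvdp0.
  by rewrite dvdp_add.
by rewrite dvdp_mull //; apply: (cP k).2; rewrite eq_sym.
Qed.

Lemma in_qpoly_eq (F : fieldType) (g p r : {poly F}) :
  (in_qpoly g p == in_qpoly g r) = (mk_monic g %| p - r).
Proof.
rewrite -subr_eq0 -raddfB -val_eqE /=.
by rewrite -Pdiv.IdomainMonic.modpE ?monic_mk_monic.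
Qed.

Lemma qpoly_unit_coprimep (F : fieldType) (h : {poly F}) (x : {poly %/ h}) :
  (x \is a GRing.unit) = coprimep (mk_monic h) x.
Proof. by []. Qed.

Section ResidueField.

Variables (F : finFieldType) (h g : {poly F}).
Hypothesis gI : monic_irreducible_poly g.
Hypothesis g_dvd_h : g %| mk_monic h.

(** An element of {poly %/ h} is its representative of smallest degree, which is
    reduced modulo g. *)
Definition residue (x : {poly %/ h}) : {poly %/ g with gI} := in_qpoly g x.

Lemma residue_eq0 x : (residue x == 0) = (g %| x).
Proof.
by rewrite -[0](in_qpoly0 g) /residue in_qpoly_eq (mk_monicE gI) subr0.
Qed.

(** Since g divides h, reducing first modulo h does not change the residue: this
    is what makes [residue] multiplicative. *)
Lemma residue_in_qpoly p : residue (in_qpoly h p) = in_qpoly g p.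
Proof.
apply/eqP; rewrite in_qpoly_eq (mk_monicE gI); apply: dvdp_trans g_dvd_h _.
rewrite /= -Pdiv.IdomainMonic.modpE ?monic_mk_monic // -dvdpNr opprB.
by rewrite {1}(divp_eq p (mk_monic h)) addrK dvdp_mull.
Qed.

Fact residue_zmod_morphism : zmod_morphism residue.
Proof. by move=> x y; rewrite -[RHS]raddfB. Qed.

Fact residue_monoid_morphism : monoid_morphism residue.
Proof.
split=> [|x y]; first exact: in_qpoly1.
by rewrite -[RHS]in_qpolyM -residue_in_qpoly.
Qed.

End ResidueField.

(** * Orders of the groups over F[x]/(h) *)

(** The quotient modulo g is given a field structure only for g monic, so the
    factors f j are replaced with their monic associates. *)
Lemma card_GL_qpoly (F : finFieldType) (h : {poly F}) (t n : nat)
    (f : 'I_t -> {poly F}) (e : 'I_t -> nat) :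
    (forall j, irreducible_poly (f j)) ->
    (forall i j, i != j -> ~~ (f i %= f j)) ->
    (forall j, (0 < e j)%N) ->
    mk_monic h = \prod_(j < t) f j ^+ e j ->
  (#|'GL_n.+1[{poly %/ h}]%g| * \prod_(j < t) (#|F| ^ (size (f j)).-1) ^ (n.+1 * n.+1)
   = #|{poly %/ h}| ^ (n.+1 * n.+1) *
     \prod_(j < t) ((#|F| ^ (size (f j)).-1) ^ 'C(n.+1, 2) *
                    \prod_(1 <= i < n.+2) ((#|F| ^ (size (f j)).-1) ^ i - 1)))%N.
Proof.
move=> f_irr f_dist e_gt0 hE.
have f0 j : f j != 0 by apply: irredp_neq0.
pose g j := (lead_coef (f j))^-1 *: f j.
have gf j : g j %= f j by apply: eqp_scale; rewrite invr_eq0 lead_coef_eq0.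
have gI j : monic_irreducible_poly (g j).
  split; last by rewrite monicE lead_coefZ mulVf // lead_coef_eq0.
  split=> [|p]; first by rewrite (eqp_size (gf j)) (f_irr j).1.
  rewrite (eqp_dvdr _ (gf j)) => sp /(f_irr j).2 - /(_ sp) pf.
  by rewrite (eqp_trans pf) // eqp_sym.
have g_co i j : i != j -> coprimep (g i) (g j).
  move=> ij; rewrite irreducible_poly_coprime; last by case: (gI i).
  rewrite (eqp_dvdl _ (gf i)) (eqp_dvdr _ (gf j)); apply: contra (f_dist _ _ ij).
  by apply: (f_irr j).2; have := (f_irr i).1; case: size => [|[]].
have g_dvd_h j : g j %| mk_monic h.
  rewrite hE (eqp_dvdl _ (gf j)) (bigD1 j) //= dvdp_mulr //.
  by rewrite -(prednK (e_gt0 j)) exprS dvdp_mulr.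
pose K j : finFieldType := {poly %/ g j with gI j}.
pose phi j : {rmorphism {poly %/ h} -> K j} :=
  HB.pack (@residue F h (g j) (gI j))
    (GRing.isZmodMorphism.Build _ _ _ (@residue_zmod_morphism F h (g j) (gI j)))
    (GRing.isMonoidMorphism.Build _ _ _ (@residue_monoid_morphism F h (g j) (gI j) (g_dvd_h j))).
have phi_onto (y : forall j, K j) : exists x, forall j, phi j x = y j.
  have [p pP] := poly_chinese g_co (fun j => polyn (y j)).
  exists (in_qpoly h p) => j.
  apply: (etrans (residue_in_qpoly (gI j) (g_dvd_h j) p)).
  have <-: in_qpoly (g j) (polyn (y j)) = y j.
    by apply/val_inj/in_qpoly_small/size_mk_monic.
  apply/eqP; rewrite in_qpoly_eq; move: (polyn (y j)) (pP j) => r.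
  by rewrite (mk_monicE (gI j)).
have phi_unit (x : {poly %/ h}) : (forall j, phi j x != 0) -> x \is a GRing.unit.
  move=> xn0; rewrite qpoly_unit_coprimep coprimep_sym.
  suff: coprimep (polyn x) (\prod_(j < t) f j ^+ e j) by rewrite -hE.
  elim/big_rec: _ => [|j p _ IHp]; first exact: coprimep1.
  rewrite coprimepMr IHp andbT coprimep_expr // coprimep_sym.
  rewrite irreducible_poly_coprime // -(eqp_dvdl _ (gf j)) -(residue_eq0 (gI j)).
  exact: xn0.
have cardK j : #|K j| = (#|F| ^ (size (f j)).-1)%N.
  by rewrite card_qfpoly (eqp_size (gf j)).
have := card_GL_residues phi_onto phi_unit n.
under eq_bigr do rewrite cardK; move=> ->; congr muln.
by apply: eq_bigr => j _; rewrite card_GL // cardK.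
Qed.

Lemma size_prod_expr (F : idomainType) t (f : 'I_t -> {poly F}) (e : 'I_t -> nat) :
    (forall j, f j != 0) ->
  (size (\prod_(j < t) f j ^+ e j)).-1 = (\sum_(j < t) (size (f j)).-1 * e j)%N.
Proof.
move=> f0; suff [] : \prod_(j < t) f j ^+ e j != 0 /\
  (size (\prod_(j < t) f j ^+ e j)).-1 = (\sum_(j < t) (size (f j)).-1 * e j)%N by [].
elim/big_rec2: _ => [|j d p _ [p0 <-]]; first by rewrite oner_eq0 size_poly1.
have fe0 : f j ^+ e j != 0 by rewrite expf_neq0.
rewrite mulf_neq0 // size_mul // -size_exp; split=> //.
by rewrite -!subn1; move: p0 fe0; rewrite -!size_poly_gt0; lia.
Qed.

(** Factoring x ^+ i out of x ^+ i - 1 contributes the exponent 'C(m.+1, 2),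
    and 'C(m, 2) + 'C(m.+1, 2) = m ^ 2. *)
Lemma prod_exp_subr1 (K : fieldType) (x : K) m : x != 0 ->
  x ^+ 'C(m, 2) * \prod_(1 <= i < m.+1) (x ^+ i - 1)
    = x ^+ (m ^ 2) * \prod_(1 <= i < m.+1) (1 - x ^- i).
Proof.
move=> x0; elim: m => [|m IHm]; first by rewrite !big_geq.
rewrite !(big_nat_recr m.+1) //= binS bin1.
have ->: (m.+1 ^ 2 = m ^ 2 + m + m.+1)%N by nia.
have -> : x ^+ m.+1 - 1 = x ^+ m.+1 * (1 - x ^- m.+1).
  by rewrite mulrBr mulr1 mulfV // expf_neq0.
by rewrite !exprD mulrACA IHm; ring.
Qed.

(** GL_1 is the unit group, since every 1 x 1 matrix is diagonal.  The count of
    GL_1 is multiplied by prod_j Q_j, with Q_j = #|F| ^ deg (f j); on the other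
    side |F[x]/(h)| = prod_j Q_j ^ e_j, and one factor Q_j cancels. *)
Lemma card_qpoly_units (F : finFieldType) (h : {poly F}) (t : nat)
    (f : 'I_t -> {poly F}) (e : 'I_t -> nat) :
    (forall j, irreducible_poly (f j)) ->
    (forall i j, i != j -> ~~ (f i %= f j)) ->
    (forall j, (0 < e j)%N) ->
    mk_monic h = \prod_(j < t) f j ^+ e j ->
  #|[set: {unit {poly %/ h}}]| =
    (\prod_(j < t) ((#|F| ^ (size (f j)).-1 - 1) *
                    #|F| ^ ((size (f j)).-1 * (e j - 1))))%N.
Proof.
move=> f_irr f_dist e_gt0 hE; have := card_GL_qpoly 0 f_irr f_dist e_gt0 hE.
have ->: #|'GL_1[{poly %/ h}]%g| = #|[set: {unit {poly %/ h}}]|.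
  rewrite -[RHS]expn1 -card_diag_units; apply: eq_card => A.
  by rewrite !inE mx11_is_diag.
have F0 : (0 < #|F|)%N by apply/card_gt0P; exists 0.
rewrite muln1 card_qpoly hE size_prod_expr => [|j]; last exact: irredp_neq0.
rewrite expn_sum -big_split /= => GLE; apply/eqP.
rewrite -(@eqn_pmul2r (\prod_(j < t) #|F| ^ (size (f j)).-1)); last first.
  by apply: prodn_gt0 => j; rewrite expn_gt0 F0.
apply/eqP; rewrite GLE -big_split; apply: eq_bigr => j _ /=.
rewrite big_nat1 expn1 mul1n -mulnA -expnD mulnC; congr muln; congr expn.
by rewrite addnC -mulnS subn1 prednK.
Qed.

Lemma card_GL_qpoly_rat (F : finFieldType) (h : {poly F}) (t n : nat)
    (f : 'I_t -> {poly F}) (e : 'I_t -> nat) :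
    (forall j, irreducible_poly (f j)) ->
    (forall i j, i != j -> ~~ (f i %= f j)) ->
    (forall j, (0 < e j)%N) ->
    mk_monic h = \prod_(j < t) f j ^+ e j ->
  (#|'GL_n.+1[{poly %/ h}]%g|%:R : rat) =
    #|{poly %/ h}|%:R ^+ (n.+1 ^ 2) *
    \prod_(j < t) \prod_(1 <= i < n.+2) (1 - #|F|%:R ^- (i * (size (f j)).-1)).
Proof.
move=> f_irr f_dist e_gt0 hE; have := card_GL_qpoly n f_irr f_dist e_gt0 hE.
have F0 : (0 < #|F|)%N by apply/card_gt0P; exists 0.
have F0R : #|F|%:R != 0 :> rat by rewrite pnatr_eq0 -lt0n.
have D0 : \prod_(j < t) (#|F|%:R ^+ (size (f j)).-1) ^+ (n.+1 ^ 2) != 0 :> rat.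
  by apply/prodf_neq0 => j _; rewrite !expf_neq0.
move=> /(congr1 (fun k => k%:R : rat)); rewrite !natrM natrX !natr_prod => GLE.
apply: (mulIf D0); rewrite -mulrA -big_split /=.
transitivity (#|'GL_n.+1[{poly %/ h}]%g|%:R * 
  \prod_(j < t) ((#|F| ^ (size (f j)).-1) ^ (n.+1 * n.+1))%:R : rat).
  by congr (_ * _); apply: eq_bigr => j _; rewrite !natrX.
rewrite GLE; congr (_ * _); apply: eq_bigr => j _.
rewrite natrM natrX natr_prod natrX.
under eq_big_nat => i /andP[i_gt0 _].
  rewrite natrB ?expn_gt0 ?F0 // !natrX.
  over.
rewrite prod_exp_subr1 ?expf_neq0 // mulrC; congr (_ * _).
by apply: eq_bigr => i _; rewrite -exprM mulnC.
Qed.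

Theorem theorem12 (F : finFieldType) (q m s t : nat)
  (f : 'I_t -> {poly F}) (e : 'I_t -> nat)
  (hq : exists p k : nat, [/\ prime p, (0 < k)%N & q = (p ^ k)%N])
  (hF : #|F| = q)
  (hm : (0 < m)%N) (hs : (0 < s)%N)
  (hirr : forall j, irreducible_poly (f j))
  (hdist : forall i j, i != j -> ~~ (f i %= f j))
  (he : forall j, (0 < e j)%N)
  (hdec : 'X^s - 1 = \prod_(j < t) f j ^+ e j) :
  let d := fun j => (size (f j)).-1 in
  [/\ #|[set: {unit (cyclic_ring F s)}]| =
        (\prod_(j < t) ((q ^ d j - 1) * q ^ (d j * (e j - 1))))%N,
      (#|SLgroup m (cyclic_ring F s)|%:R : rat) =
        q%:R ^+ (m ^ 2 * s) *
        (\prod_(j < t) \prod_(1 <= i < m.+1) (1 - q%:R ^- (i * d j))) /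
        (\prod_(j < t) ((q%:R ^+ d j - 1) * q%:R ^+ (d j * (e j - 1)))),
      #|Bgroup m (cyclic_ring F s)| =
        (q ^ (s * ((m * (m - 1)) %/ 2)) *
         (\prod_(j < t) ((q ^ d j - 1) * q ^ (d j * (e j - 1)))) ^ m)%N
    & #|Dgroup m (cyclic_ring F s)| =
        ((\prod_(j < t) ((q ^ d j - 1) * q ^ (d j * (e j - 1)))) ^ m)%N].
Proof.
move=> d; case: m hm => // n _.
have hE := etrans (cyclic_ring_modulus F hs) hdec.
have cardR : #|cyclic_ring F s| = (q ^ s)%N.
  by rewrite card_qpoly (cyclic_ring_modulus F hs) size_XnsubC // hF.
have cardU : #|[set: {unit (cyclic_ring F s)}]| =
    (\prod_(j < t) ((q ^ d j - 1) * q ^ (d j * (e j - 1))))%N.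
  by rewrite -hF; apply: card_qpoly_units hE.
have q_gt0 : (0 < q)%N by rewrite -hF; apply/card_gt0P; exists 0.
split=> //; last by rewrite card_diag_units cardU.
  have cardUR : #|[set: {unit (cyclic_ring F s)}]|%:R =
      \prod_(j < t) ((q%:R ^+ d j - 1) * q%:R ^+ (d j * (e j - 1))) :> rat.
    rewrite cardU natr_prod; apply: eq_bigr => j _.
    by rewrite natrM natrB ?expn_gt0 ?q_gt0 // !natrX.
  rewrite -cardUR; apply: (@mulIf _ #|[set: {unit (cyclic_ring F s)}]|%:R).
    by rewrite pnatr_eq0 -lt0n cardsT; apply/card_gt0P; exists 1%g.
  rewrite divfK; last first.
    by rewrite pnatr_eq0 -lt0n cardsT; apply/card_gt0P; exists 1%g.
  rewrite -natrM mulnC -card_SL_units.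
  have := card_GL_qpoly_rat n hirr hdist he hE.
  by rewrite -[#|{poly %/ _}|]/#|cyclic_ring F s| cardR hF natrX -exprM mulnC => <-.
by rewrite card_triangular_units cardU cardR -expnM bin2 divn2 subn1.
Qed.
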